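(* Suppose that $K$ is a set equipped with two metrics $d_0 \le d_1$ (i.e. $d_0(x,y)\le d_1(x,y)$ for all $x,y\in K$) such that $(K,d_0)$ and $(K,d_1)$ are both compact positive definite metric spaces. For $0\le t\le 1$ let $K_t = (K,d_t)$, where $$d_t(x,y) = -\log\bigl[(1-t)e^{-d_0(x,y)} + t e^{-d_1(x,y)}\bigr].$$ Then $$\mathrm{Mag}(K_t) \le (1-t)\,\mathrm{Mag}(K_0) + t\,\mathrm{Mag}(K_1)$$ for every $0\le t\le 1$. In other words, $\mathrm{Mag}(K_t)$ is convex in $t$.
   Context: For a finite metric space $X = \{1,\dots,n\}$ with metric $d$, the zeta matrix is the real $n\times n$ matrix $Z_X = (e^{-d(i,j)})_{i,j}$. If $Z_X$ is invertible, the magnitude is $\mathrm{Mag}(X) = \langle \mathbf{1}, Z_X^{-1}\mathbf{1}\rangle$, the sum of the entries of $Z_X^{-1}$ (where $\mathbf{1}\in\mathbb{R}^n$ has all entries $1$). A finite metric space $X$ is positive definite if $Z_X$ is a positive definite matrix. A compact metric space $K$ is positive definite if every finite metric subspace of $K$ is positive definite. The magnitude of a compact positive definite metric space $K$ is $\mathrm{Mag}(K) = \sup\{\mathrm{Mag}(X) : X\subseteq K \text{ finite}\}$, which may equal $+\infty$. Under the hypotheses of the claim, each $d_t$ ($0\le t\le1$) is a metric on $K$ for which $(K,d_t)$ is compact and positive definite, so $\mathrm{Mag}(K_t)\in[0,\infty]$ is defined. Arithmetic is in $[0,\infty]$ with the convention $0\cdot\infty=0$. *)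

(* Defs.v *)
From HB Require Import structures.
From mathcomp Require Import all_boot all_order all_algebra finmap.
From mathcomp Require Import boolp classical_sets reals ereal topology.
From mathcomp Require Import normedtype sequences exp lra.

Set Implicit Arguments.
Unset Strict Implicit.
Unset Printing Implicit Defensive.

Import Order.TTheory GRing.Theory Num.Theory.

Local Open Scope classical_set_scope.
Local Open Scope ring_scope.

(* A metric as a first-class object, so that one set can carry several. *)
Record metric (R : realType) (K : Type) := Metric {
  dist :> K -> K -> R ;
  distxx : forall x, dist x x = 0 ;
  dist_positivity : forall x y, dist x y = 0 -> x = y ;
  dist_sym : forall x y, dist x y = dist y x ;
  dist_triangle : forall y x z, dist x z <= dist x y + dist y z
}.

(* The pair (K, d) as a library metric space: an alias of K whose [mdist] is d
   and whose topology is the one induced by d. *)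
Definition metric_space (R : realType) (K : choiceType) (d : metric R K)
  : Type := K.

HB.instance Definition _ (R : realType) (K : choiceType) (d : metric R K) :=
  Choice.on (metric_space d).
HB.instance Definition _ (R : realType) (K : choiceType) (d : metric R K) :=
  @isMetric.Build R (metric_space d) d
    (distxx d) (@dist_positivity _ _ d) (dist_sym d) (dist_triangle d).

Definition posdef_mx (R : realType) (n : nat) (A : 'M[R]_n) : Prop :=
  A^T = A /\
  forall v : 'cV[R]_n, v != 0 -> 0 < (v^T *m A *m v) ord0 ord0.

(* The points of the finite subspace X are numbered by [enum_val]; the choice
   of numbering affects neither definiteness nor magnitude. *)
Definition zeta_mx (R : realType) (M : metricType R) (X : {fset M})
  : 'M[R]_#|{: X}| :=
  \matrix_(i, j) expR (- mdist (val (enum_val i)) (val (enum_val j))).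

Definition positive_definite (R : realType) (M : metricType R) : Prop :=
  forall X : {fset M}, posdef_mx (zeta_mx X).

(* Meaningful when [zeta_mx X] is invertible, as it is in every positive
   definite space. *)
Definition fin_magnitude (R : realType) (M : metricType R) (X : {fset M}) : R :=
  \sum_i \sum_j invmx (zeta_mx X) i j.

(* The empty set is among the finite subsets, so this is nonnegative. *)
Definition magnitude (R : realType) (M : metricType R) : \bar R :=
  ereal_sup [set (fin_magnitude X)%:E | X in [set: {fset M}]].

Section interpolation.
Context (R : realType) (K : choiceType) (d0 d1 : metric R K).
Hypothesis led : forall x y, d0 x y <= d1 x y.
Context (t : R).
Hypothesis t01 : 0 <= t <= 1.

Definition interp_dist (x y : K) : R :=
  - ln ((1 - t) * expR (- d0 x y) + t * expR (- d1 x y)).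

Lemma expR_interp x y : expR (- interp_dist x y) =
  (1 - t) * expR (- d0 x y) + t * expR (- d1 x y).
Proof.
rewrite opprK lnK// posrE.
have := expR_gt0 (- d0 x y); have := expR_gt0 (- d1 x y).
by have := t01; nra.
Qed.

Lemma interp_dist_le x y : interp_dist x y <= d1 x y.
Proof.
rewrite -lerN2 -ler_expR expR_interp.
have : expR (- d1 x y) <= expR (- d0 x y) by rewrite ler_expR lerN2.
by have := t01; nra.
Qed.

Lemma le_interp_dist x y : d0 x y <= interp_dist x y.
Proof.
rewrite -lerN2 -ler_expR expR_interp.
have : expR (- d1 x y) <= expR (- d0 x y) by rewrite ler_expR lerN2.
by have := t01; nra.
Qed.

Lemma dist_ge0 (d : metric R K) x y : 0 <= d x y.
Proof.
by have := dist_triangle d y x x; rewrite distxx (dist_sym d y x); lra.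
Qed.

Lemma interp_distxx x : interp_dist x x = 0.
Proof. by rewrite /interp_dist !distxx oppr0 expR0 !mulr1 subrK ln1 oppr0. Qed.

Lemma interp_dist_positivity x y : interp_dist x y = 0 -> x = y.
Proof.
move=> h; apply: (@dist_positivity _ _ d0); apply/le_anti.
by rewrite dist_ge0 andbT -h le_interp_dist.
Qed.

Lemma interp_dist_sym x y : interp_dist x y = interp_dist y x.
Proof. by rewrite /interp_dist (dist_sym d0) (dist_sym d1). Qed.

Lemma interp_dist_triangle y x z :
  interp_dist x z <= interp_dist x y + interp_dist y z.
Proof.
rewrite -lerN2 opprD -ler_expR expRD !expR_interp.
have h (d : metric R K) :
    expR (- d x y) * expR (- d y z) <= expR (- d x z).
  by rewrite -expRD ler_expR -opprD lerN2 dist_triangle.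
have := h d0; have := h d1.
have : expR (- d1 x y) <= expR (- d0 x y) by rewrite ler_expR lerN2.
have : expR (- d1 y z) <= expR (- d0 y z) by rewrite ler_expR lerN2.
move: t01 => /andP[].
move: (expR (- d0 x y)) (expR (- d1 x y)) (expR (- d0 y z)) (expR (- d1 y z))
  (expR (- d0 x z)) (expR (- d1 x z)) => a b a' b' A B t0 t1 ba' ba hB hA.
have h0 : 0 <= t * (1 - t) * ((a - b) * (a' - b')).
  by rewrite !mulr_ge0// subr_ge0.
have h1 : 0 <= t * (B - b * b') by rewrite mulr_ge0// subr_ge0.
have h2 : 0 <= (1 - t) * (A - a * a') by rewrite mulr_ge0// subr_ge0.
by lra.
Qed.

Definition interp_metric : metric R K :=
  Metric interp_distxx interp_dist_positivity
    interp_dist_sym interp_dist_triangle.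

Lemma interp_compact : compact [set: metric_space d1] ->
  compact [set: metric_space interp_metric].
Proof.
move=> c1; pose f (x : metric_space d1) : metric_space interp_metric := x.
have -> : [set: metric_space interp_metric] = f @` setT.
  by apply/seteqP; split => x // _; exists x.
apply: continuous_compact => //.
apply: continuous_subspaceT => x P /nbhs_ballP[e /= e0 eP].
rewrite nbhs_simpl/=.
apply/(@nbhs_ballP _ (metric_space d1)); exists e => // y xey.
apply: eP; move: xey; rewrite !ballEmdist/=.
exact: le_lt_trans (interp_dist_le _ _).
Qed.

Lemma interp_positive_definite : positive_definite (metric_space d0) ->
  positive_definite (metric_space d1) ->
  positive_definite (metric_space interp_metric).
Proof.
move=> p0 p1 X.
have -> : zeta_mx (X : {fset metric_space interp_metric}) =
    (1 - t) *: zeta_mx (X : {fset metric_space d0}) +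
    t *: zeta_mx (X : {fset metric_space d1}).
  by apply/matrixP => i j; rewrite !mxE expR_interp.
have [s0 v0] := p0 X; have [s1 v1] := p1 X.
split; first by rewrite linearD/= !linearZ/= s0 s1.
move=> v vN0; rewrite mulmxDr mulmxDl -!scalemxAr -!scalemxAl !mxE.
by have := v0 _ vN0; have := v1 _ vN0; rewrite !mxE; have := t01; nra.
Qed.

End interpolation.

Lemma conv01 (R : realType) (s u l : R) :
  0 <= s <= 1 -> 0 <= u <= 1 -> 0 <= l <= 1 ->
  0 <= (1 - l) * s + l * u <= 1.
Proof. by move=> ? ? ?; apply/andP; split; nra. Qed.

(* Main.v *)
Require Import Defs.
From mathcomp Require Import all_boot all_order all_algebra finmap.
From mathcomp Require Import classical_sets reals ereal topology.
From mathcomp Require Import sequences ring lra.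

Import Order.TTheory GRing.Theory Num.Theory.

Local Open Scope classical_set_scope.
Local Open Scope ring_scope.

(** For a positive definite matrix [A] one has the variational formula
    [w^T A^-1 w = max_v (2 w^T v - v^T A v)], attained at [v = A^-1 w].  The
    right-hand side is a maximum of functions that are affine in [A], so it is
    convex in [A].  The zeta matrix of a finite subset is affine in the
    interpolation parameter, so taking [w] to be the all-ones vector gives
    convexity of finite magnitudes, and this passes to suprema. *)

Definition dot {R : pzSemiRingType} {n : nat} (u v : 'cV[R]_n) : R :=
  (u^T *m v) ord0 ord0.

Definition quad_form {R : pzSemiRingType} {n : nat} (A : 'M[R]_n)
  (v : 'cV[R]_n) : R := (v^T *m A *m v) ord0 ord0.

Lemma dotC {R : comPzSemiRingType} {n : nat} (u v : 'cV[R]_n) :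
  dot u v = dot v u.
Proof. by rewrite /dot -[u^T *m v]trmxK trmx_mul trmxK mxE. Qed.

Lemma quad_formD {R : pzSemiRingType} {n : nat} (A B : 'M[R]_n)
    (v : 'cV[R]_n) : quad_form (A + B) v = quad_form A v + quad_form B v.
Proof. by rewrite /quad_form mulmxDr mulmxDl mxE. Qed.

Lemma quad_formZ {R : comPzSemiRingType} {n : nat} (a : R) (A : 'M[R]_n)
    (v : 'cV[R]_n) : quad_form (a *: A) v = a * quad_form A v.
Proof. by rewrite /quad_form -scalemxAr -scalemxAl mxE. Qed.

Lemma quad_form_const1 {R : pzSemiRingType} {n : nat} (A : 'M[R]_n) :
  quad_form A (const_mx 1) = \sum_i \sum_j A i j.
Proof.
rewrite /quad_form mxE exchange_big; apply: eq_bigr => j _.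
by rewrite !mxE mulr1; apply: eq_bigr => i _; rewrite !mxE mul1r.
Qed.

Lemma quad_form_complete_square {R : comUnitRingType} {n : nat} {A : 'M[R]_n}
    (v w : 'cV[R]_n) : A^T = A -> A \in unitmx ->
  quad_form A (v - invmx A *m w) =
    quad_form A v - 2 * dot w v + quad_form (invmx A) w.
Proof.
move=> symA unitA.
have -> : quad_form A (v - invmx A *m w) =
    quad_form A v - dot w v - (dot v w - quad_form (invmx A) w).
  rewrite /quad_form /dot [(_ - _)^T]linearB/= trmx_mul trmx_inv symA.
  rewrite !(mulmxBl, mulmxBr) !mulmxA (mulmxK unitA) (mulmxKV unitA).
  by rewrite !mxE.
by rewrite (dotC v w); ring.
Qed.

Section posdef_mx_theory.
Context {R : realType} {n : nat}.
Implicit Types (A B : 'M[R]_n) (v w : 'cV[R]_n) (l : R).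

Lemma posdef_quad_form_ge0 {A} v : posdef_mx A -> 0 <= quad_form A v.
Proof.
move=> [_ posA]; have [->|/posA/ltW//] := eqVneq v 0.
by rewrite /quad_form mulmx0 mxE.
Qed.

Lemma posdef_unitmx {A} : posdef_mx A -> A \in unitmx.
Proof.
move=> [_ posA]; rewrite unitmxE unitfE; apply/negP => /det0P[v vN0 vA0].
have vTN0 : v^T != 0 by rewrite -trmx0 (inj_eq trmx_inj).
by have := posA _ vTN0; rewrite trmxK vA0 mul0mx mxE ltxx.
Qed.

Lemma posdef_mx_conv {A B l} : 0 <= l <= 1 ->
  posdef_mx A -> posdef_mx B -> posdef_mx ((1 - l) *: A + l *: B).
Proof.
move=> l01 [symA posA] [symB posB].
split=> [|v vN0]; first by rewrite linearD/= !linearZ/= symA symB.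
rewrite -/(quad_form _ v) quad_formD !quad_formZ.
have : 0 < quad_form A v := posA v vN0.
have : 0 < quad_form B v := posB v vN0.
by nra.
Qed.

Lemma posdef_variational_le {A} v w : posdef_mx A ->
  2 * dot w v - quad_form A v <= quad_form (invmx A) w.
Proof.
move=> posA; have := posdef_quad_form_ge0 (v - invmx A *m w) posA.
by rewrite (quad_form_complete_square _ _ posA.1 (posdef_unitmx posA)); lra.
Qed.

Lemma posdef_variational_eq {A} w : posdef_mx A ->
  2 * dot w (invmx A *m w) - quad_form A (invmx A *m w) =
    quad_form (invmx A) w.
Proof.
move=> posA; have := quad_form_complete_square (invmx A *m w) w posA.1
  (posdef_unitmx posA).
by rewrite subrr {1}/quad_form mulmx0 mxE; lra.
Qed.

Lemma quad_form_invmx_convex {A B l} w : 0 <= l <= 1 ->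
  posdef_mx A -> posdef_mx B ->
  quad_form (invmx ((1 - l) *: A + l *: B)) w <=
    (1 - l) * quad_form (invmx A) w + l * quad_form (invmx B) w.
Proof.
move=> l01 posA posB.
rewrite -(posdef_variational_eq w (posdef_mx_conv l01 posA posB)).
set v := (v in dot w v); rewrite quad_formD !quad_formZ.
move: l01 => /andP[l_ge0]; rewrite -subr_ge0 => l_le1.
have := ler_wpM2l l_le1 (posdef_variational_le v w posA).
have := ler_wpM2l l_ge0 (posdef_variational_le v w posB).
by lra.
Qed.

End posdef_mx_theory.

Lemma fin_magnitude_quad_form {R : realType} {M : metricType R}
    (X : {fset M}) :
  fin_magnitude X = quad_form (invmx (zeta_mx X)) (const_mx 1).
Proof. by rewrite quad_form_const1. Qed.

Section magnitude_convexity.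
Context {R : realType} {K : choiceType} {d0 d1 d : metric R K} {l : R}.
Hypothesis l01 : 0 <= l <= 1.
Hypothesis expR_conv : forall x y,
  expR (- d x y) = (1 - l) * expR (- d0 x y) + l * expR (- d1 x y).

Lemma fin_magnitude_convex (X : {fset metric_space d}) :
  posdef_mx (zeta_mx (X : {fset metric_space d0})) ->
  posdef_mx (zeta_mx (X : {fset metric_space d1})) ->
  fin_magnitude X <=
    (1 - l) * fin_magnitude (X : {fset metric_space d0}) +
    l * fin_magnitude (X : {fset metric_space d1}).
Proof.
move=> pos0 pos1; rewrite !fin_magnitude_quad_form.
have -> : zeta_mx X =
    (1 - l) *: zeta_mx (X : {fset metric_space d0}) +
    l *: zeta_mx (X : {fset metric_space d1}).
  by apply/matrixP => i j; rewrite !mxE expR_conv.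
exact: quad_form_invmx_convex.
Qed.

Lemma magnitude_convex :
  positive_definite (metric_space d0) -> positive_definite (metric_space d1) ->
  (magnitude (metric_space d) <=
    (1 - l)%:E * magnitude (metric_space d0) +
    l%:E * magnitude (metric_space d1))%E.
Proof.
move=> posdef0 posdef1; apply: ge_ereal_sup => _ [X _ <-].
have := fin_magnitude_convex X (posdef0 X) (posdef1 X).
rewrite -lee_fin EFinD !EFinM => /le_trans; apply.
have /andP[l_ge0 l_le1] := l01.
by apply: leeD; apply: lee_wpmul2l; rewrite ?lee_fin ?subr_ge0//;
  apply: ereal_sup_ubound; exists X.
Qed.

End magnitude_convexity.

Lemma expR_interp_conv {R : realType} {K : choiceType} (d0 d1 : metric R K)
    {s u l : R} : 0 <= s <= 1 -> 0 <= u <= 1 -> 0 <= l <= 1 -> forall x y,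
  expR (- interp_dist d0 d1 ((1 - l) * s + l * u) x y) =
    (1 - l) * expR (- interp_dist d0 d1 s x y) +
    l * expR (- interp_dist d0 d1 u x y).
Proof.
move=> s01 u01 l01 x y.
by rewrite !expR_interp//; [ring | exact: conv01].
Qed.

Theorem theorem1p4 (R : realType) (K : choiceType) (d0 d1 : metric R K)
  (led : forall x y : K, d0 x y <= d1 x y)
  (compact0 : compact [set: metric_space d0])
  (posdef0 : positive_definite (metric_space d0))
  (compact1 : compact [set: metric_space d1])
  (posdef1 : positive_definite (metric_space d1)) :
  (forall (t : R) (t01 : 0 <= t <= 1),
     (magnitude (metric_space (interp_metric led t01)) <=
      (1 - t)%:E * magnitude (metric_space d0) +
      t%:E * magnitude (metric_space d1))%E) /\
  (forall (s u l : R) (s01 : 0 <= s <= 1) (u01 : 0 <= u <= 1)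
     (l01 : 0 <= l <= 1),
     (magnitude (metric_space (interp_metric led (conv01 s01 u01 l01))) <=
      (1 - l)%:E * magnitude (metric_space (interp_metric led s01)) +
      l%:E * magnitude (metric_space (interp_metric led u01)))%E).
Proof.
have interp_posdef t (t01 : 0 <= t <= 1) :
    positive_definite (metric_space (interp_metric led t01)).
  exact: interp_positive_definite.
split=> [t t01|s u l s01 u01 l01].
  by apply: magnitude_convex => // x y; exact: expR_interp.
by apply: magnitude_convex => //; exact: expR_interp_conv.
Qed.
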